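(* Generically, each local minimizer of the sparse recovery problem is nondegenerate with active sparsity constraint. That is, there exists an open and dense subset of $\mathbb{R}^{m\times n}\times\mathbb{R}^m$ such that for every $(A,b)$ in this subset, each local minimizer $\bar x\in\mathbb{R}^{n,s}$ of $\mathrm{SR}(A,b)$ is a nondegenerate M-stationary point of $\mathrm{SR}(A,b)$ and satisfies $\|\bar x\|_0=s$.
   Context: Fix integers $m,n$ and $s\in\{0,1,\ldots,n-1\}$ with $s\le m$ (standing assumption). For $x\in\mathbb{R}^n$, $\|x\|_0$ is the number of non-zero entries of $x$, and $\mathbb{R}^{n,s}=\{x\in\mathbb{R}^n : \|x\|_0\le s\}$. For $(A,b)\in\mathbb{R}^{m\times n}\times\mathbb{R}^m$, the sparse recovery problem $\mathrm{SR}(A,b)$ is to minimize $f(x)=\frac12\|Ax-b\|_2^2$ subject to $x\in\mathbb{R}^{n,s}$. A local minimizer is a local minimizer of $f$ restricted to $\mathbb{R}^{n,s}$. For $x\in\mathbb{R}^{n,s}$ put $I_0(x)=\{i : x_i=0\}$ and $I_1(x)=\{j : x_j\neq 0\}$. For an index set $I\subset\{1,\ldots,n\}$, $A_I$ is the submatrix of $A$ formed by the columns with index in $I$, $A_I^T$ is its transpose, and $x_I$ is the subvector of $x$ with entries indexed by $I$ (terms with empty index set are zero, conditions on an empty index set are vacuous). A point $\bar x\in\mathbb{R}^{n,s}$ is called M-stationary for $\mathrm{SR}(A,b)$ if $A_{I_1(\bar x)}^TA_{I_1(\bar x)}\bar x_{I_1(\bar x)}-A_{I_1(\bar x)}^Tb=0$.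 An M-stationary point $\bar x$ is called nondegenerate if both of the following hold: (ND1) if $\|\bar x\|_0<s$, then all entries of the vector $A_{I_0(\bar x)}^TA_{I_1(\bar x)}\bar x_{I_1(\bar x)}-A_{I_0(\bar x)}^Tb$ are non-zero; (ND2) $\mathrm{rank}(A_{I_1(\bar x)})=\|\bar x\|_0$. *)

(* Defs.v *)
From mathcomp Require Import all_boot all_order all_algebra.
From mathcomp Require Import classical_sets reals topology normedtype.

Set Implicit Arguments.
Unset Strict Implicit.
Unset Printing Implicit Defensive.

Import Order.TTheory GRing.Theory Num.Theory.
Import numFieldNormedType.Exports.

Local Open Scope classical_set_scope.
Local Open Scope ring_scope.

Section SparseRecovery.
Variable R : realType.

Definition I0 n (x : 'cV[R]_n) : {set 'I_n} := [set i | x i 0 == 0]%SET.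
Definition I1 n (x : 'cV[R]_n) : {set 'I_n} := [set i | x i 0 != 0]%SET.

Definition norm0 n (x : 'cV[R]_n) : nat := #|I1 x|.

Definition sparse_vectors n (s : nat) : set 'cV[R]_n :=
  [set x | (norm0 x <= s)%N].

(* The norm that the library puts on matrices is the sup norm. *)
Definition norm2 n (v : 'cV[R]_n) : R := Num.sqrt (\sum_i v i 0 ^+ 2).

Definition SR_objective m n (A : 'M[R]_(m, n)) (b : 'cV[R]_m)
  (x : 'cV[R]_n) : R := 2^-1 * norm2 (A *m x - b) ^+ 2.

Definition local_minimizer m n (s : nat) (A : 'M[R]_(m, n)) (b : 'cV[R]_m)
    (x : 'cV[R]_n) : Prop :=
  sparse_vectors s x /\
  \forall y \near within (sparse_vectors s) (nbhs x),
    SR_objective A b x <= SR_objective A b y.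

(* Entries keep the increasing order of their indices in I. *)
Definition cols m n (A : 'M[R]_(m, n)) (I : {set 'I_n}) : 'M[R]_(m, #|I|) :=
  colsub (fun k : 'I_#|I| => enum_val k) A.
Definition subvec n (x : 'cV[R]_n) (I : {set 'I_n}) : 'cV[R]_#|I| :=
  rowsub (fun k : 'I_#|I| => enum_val k) x.

Definition M_stationary m n (s : nat) (A : 'M[R]_(m, n)) (b : 'cV[R]_m)
    (x : 'cV[R]_n) : Prop :=
  sparse_vectors s x /\
  (cols A (I1 x))^T *m cols A (I1 x) *m subvec x (I1 x)
    - (cols A (I1 x))^T *m b = 0.

Definition ND1 m n (s : nat) (A : 'M[R]_(m, n)) (b : 'cV[R]_m)
    (x : 'cV[R]_n) : Prop :=
  (norm0 x < s)%N ->
  forall k : 'I_#|I0 x|,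
    ((cols A (I0 x))^T *m cols A (I1 x) *m subvec x (I1 x)
      - (cols A (I0 x))^T *m b) k 0 != 0.

Definition ND2 m n (A : 'M[R]_(m, n)) (x : 'cV[R]_n) : Prop :=
  \rank (cols A (I1 x)) = norm0 x.

Definition nondegenerate_M_stationary m n (s : nat) (A : 'M[R]_(m, n))
    (b : 'cV[R]_m) (x : 'cV[R]_n) : Prop :=
  [/\ M_stationary s A b x, ND1 s A b x & ND2 A x].

End SparseRecovery.

(* Main.v *)
Require Import Defs.
From mathcomp Require Import all_boot all_order all_algebra.
From mathcomp Require Import boolp classical_sets reals topology normedtype derive.
From mathcomp Require Import ring lra.
Import Order.TTheory GRing.Theory Num.Theory.
Import numFieldNormedType.Exports.
Local Open Scope classical_set_scope.
Local Open Scope ring_scope.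

(** Write [A_J] for the submatrix of the columns of [A] in [J].  Let [x] be a
    local minimizer with support [I].  Moving one coordinate [j] keeps [x]
    feasible whenever [j] is in [I], and for every [j] if [|I| < s]; along such
    a line the objective is a quadratic, so the [j]-th entry of the gradient
    [A^T (A x - b)] vanishes ([local_minimizer_gradient]).  This already gives
    M-stationarity.

    If [|I| < s], pick [j] outside [I] (there is one since [s < n]) and put
    [J = j |: I], so that [|J| <= s].  Then [A_J^T (A x - b) = 0].  Let [C] be
    [A_J] with its column [j] replaced by [b].  Since [x_j = 0], the residual
    [A x - b] is [C z] for [z] equal to [x_J] except for the entry [-1] at [j].
    Hence the square matrix [A_J^T C] kills a nonzero vector, that is, its
    determinant vanishes ([gradient_neq0]).  The data for which some
    [det (A_J^T C)] vanishes, with [j] in [J] and [|J| <= s], are therefore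
    excluded; outside them [|I| = s].  The same condition with [J = I] forces
    [A_I] to have full column rank ([mxrank_cols]), which is ND2, while ND1 is
    vacuous when [|I| = s].

    It remains to see that finitely many conditions [det (A_J^T C) != 0] define
    an open dense set.  Each determinant is continuous in [(A, b)] and
    restricts to a univariate polynomial on every line.  It is nonzero
    somewhere, because [|J| <= s <= m] makes it possible to choose
    [A_J = C = (1 0)^T], and a nonzero univariate polynomial has isolated
    roots; so arbitrarily close to any datum on the line through this good one
    the determinant is nonzero ([dense_polynomial_fun_neq0]). *)

(** * Functions that are polynomial along lines *)

Section PolynomialFunctions.
Context {R : realType} {V : normedModType R}.
Implicit Types f g : V -> R.

(** Being polynomial on every line is a coordinate-free condition on [V], stable
    under sums and products, and is what the density argument needs. *)
Definition polynomial_fun f : Prop :=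
  continuous f /\
  forall v w : V, exists p : {poly R}, forall t, f (v + t *: w) = p.[t].

Lemma polynomial_fun_cst (c : R) : polynomial_fun (fun=> c).
Proof.
split; first exact: cst_continuous.
by move=> v w; exists c%:P => t; rewrite hornerC.
Qed.

Lemma polynomial_funD f g :
  polynomial_fun f -> polynomial_fun g -> polynomial_fun (fun v => f v + g v).
Proof.
move=> [cf pf] [cg pg]; split=> [v|v w]; first exact: cvgD (cf v) (cg v).
have [p Ep] := pf v w; have [q Eq] := pg v w.
by exists (p + q) => t; rewrite Ep Eq hornerD.
Qed.

Lemma polynomial_funM f g :
  polynomial_fun f -> polynomial_fun g -> polynomial_fun (fun v => f v * g v).
Proof.
move=> [cf pf] [cg pg]; split=> [v|v w]; first exact: cvgM (cf v) (cg v).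
have [p Ep] := pf v w; have [q Eq] := pg v w.
by exists (p * q) => t; rewrite Ep Eq hornerM.
Qed.

Lemma polynomial_fun_sum I (r : seq I) (F : I -> V -> R) :
  (forall i, polynomial_fun (F i)) ->
  polynomial_fun (fun v => \sum_(i <- r) F i v).
Proof.
move=> pF; elim: r => [|i r IHr].
  under eq_fun do rewrite big_nil; exact: polynomial_fun_cst.
by under eq_fun do rewrite big_cons; exact: polynomial_funD.
Qed.

Lemma polynomial_fun_prod I (r : seq I) (F : I -> V -> R) :
  (forall i, polynomial_fun (F i)) ->
  polynomial_fun (fun v => \prod_(i <- r) F i v).
Proof.
move=> pF; elim: r => [|i r IHr].
  under eq_fun do rewrite big_nil; exact: polynomial_fun_cst.
by under eq_fun do rewrite big_cons; exact: polynomial_funM.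
Qed.

Lemma polynomial_fun_det p (M : V -> 'M[R]_p) :
  (forall i j, polynomial_fun (fun v => M v i j)) ->
  polynomial_fun (fun v => \det (M v)).
Proof.
move=> pM; apply: polynomial_fun_sum => sigma.
apply: polynomial_funM; first exact: polynomial_fun_cst.
exact: polynomial_fun_prod.
Qed.

Lemma open_polynomial_fun_neq0 f :
  polynomial_fun f -> open [set v | f v != 0].
Proof.
move=> [cf _].
have -> : [set v | f v != 0] = f @^-1` [set y | y != 0] by [].
by apply: open_comp => [v _|]; [exact: cf | exact: open_neq].
Qed.

(** Factor out the root [0]: near [0] the cofactor stays nonzero by continuity,
    and the power of ['X] vanishes at [0] only. *)
Lemma near0_horner_neq0 (p : {poly R}) :
  p != 0 -> \forall t \near 0^', p.[t] != 0.
Proof.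
move=> p0; have [k [q]] := multiplicity_XsubC p 0; rewrite p0 /= => q0 ->.
have nq : \forall t \near (0 : R), q.[t] != 0.
  have cq : horner q @ (0 : R) --> q.[0] by exact: continuous_horner.
  have /cq // : nbhs q.[0] [set y | y != 0].
  by apply: open_nbhs_nbhs; split; [exact: open_neq | exact: q0].
apply: filterS2 (nbhs_dnbhs_neq (0 : R)) (nbhs_dnbhs nq) => t t0 qt.
rewrite hornerM horner_exp hornerXsubC subr0.
by rewrite mulf_neq0 ?expf_neq0.
Qed.

Lemma cvg_line (v w : V) : v + t *: w @[t --> (0 : R)] --> v.
Proof.
rewrite -[X in _ --> X]addr0 -(scale0r w).
by apply: cvgD; [exact: cvg_cst | apply: cvgZr_tmp; exact: cvg_id].
Qed.

(** On the line from [v] to a point where [f] does not vanish, [f] is a nonzero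
    polynomial in the parameter, so its roots do not accumulate at [v]. *)
Lemma dense_polynomial_fun_neq0 f :
  polynomial_fun f -> (exists v, f v != 0) -> dense [set v | f v != 0].
Proof.
move=> [_ pf] [w fw] O [v Ov] oO.
have [p Ep] := pf v (w - v).
have p0 : p != 0.
  apply: contraNneq fw => p0.
  by have := Ep 1; rewrite p0 horner0 scale1r subrKC => ->.
have nO : \forall t \near 0^', O (v + t *: (w - v)).
  by apply: nbhs_dnbhs; apply: cvg_line; exact: open_nbhs_nbhs.
have [t [Ot pt]] :=
  filter_ex (filterI nO (near0_horner_neq0 p p0)).
by exists (v + t *: (w - v)); split; rewrite /= ?Ep.
Qed.

End PolynomialFunctions.

Lemma open_dense_finite_inter (T : topologicalType) (I : finType) (P : pred I)
    (F : I -> set T) :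
  (forall i, P i -> open (F i) /\ dense (F i)) ->
  open [set v | forall i, P i -> F i v] /\
  dense [set v | forall i, P i -> F i v].
Proof.
move=> odF.
have -> : [set v | forall i, P i -> F i v] = \big[setI/setT]_(i | P i) F i.
  apply/seteqP; split=> v /=.
    by move=> Fv; elim/big_ind: _.
  by move=> + i Pi; rewrite (bigD1 i) //= => -[].
elim/big_rec: _ => [|i A Pi [oA dA]].
  by split; [exact: openT | move=> O O0 _; rewrite setIT].
have [oF dF] := odF i Pi.
by split; [exact: openI | exact: denseI].
Qed.

(** * Generic data *)

Section SparseRecoveryGenericity.
Context {R : realType} {m n : nat}.
Implicit Types (A : 'M[R]_(m, n)) (b : 'cV[R]_m) (x : 'cV[R]_n).
Implicit Types (J : {set 'I_n}).

Definition replace_col A b J (k : 'I_#|J|) : 'M[R]_(m, #|J|) :=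
  \matrix_(i, l) if l == k then b i 0 else cols A J i l.

(** Square, so that one determinant expresses both genericity requirements: full
    column rank of [cols A J], and the absence of a vector supported on [J]
    minus its [k]-th index whose residual is orthogonal to [cols A J]. *)
Definition mixed_gram A b J (k : 'I_#|J|) : 'M[R]_#|J| :=
  (cols A J)^T *m replace_col A b J k.

Lemma polynomial_fun_fst i j :
  @polynomial_fun R ('M[R]_(m, n) * 'cV[R]_m)%type (fun Ab => Ab.1 i j).
Proof.
split=> [Ab|v w].
  apply: (@cvg_comp _ _ _ fst (fun A : 'M[R]_(m, n) => A i j)).
    exact: cvg_fst.
  exact: coord_continuous.
exists ((v.1 i j)%:P + w.1 i j *: 'X) => t.
by rewrite !hornerE /= !mxE mulrC.
Qed.

Lemma polynomial_fun_snd i j :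
  @polynomial_fun R ('M[R]_(m, n) * 'cV[R]_m)%type (fun Ab => Ab.2 i j).
Proof.
split=> [Ab|v w].
  apply: (@cvg_comp _ _ _ snd (fun b : 'cV[R]_m => b i j)).
    exact: cvg_snd.
  exact: coord_continuous.
exists ((v.2 i j)%:P + w.2 i j *: 'X) => t.
by rewrite !hornerE /= !mxE mulrC.
Qed.

Lemma polynomial_fun_det_mixed_gram J k :
  @polynomial_fun R ('M[R]_(m, n) * 'cV[R]_m)%type
    (fun Ab => \det (mixed_gram Ab.1 Ab.2 J k)).
Proof.
apply: polynomial_fun_det => i j.
under eq_fun do rewrite mxE.
apply: polynomial_fun_sum => l; apply: polynomial_funM.
  by under eq_fun do rewrite !mxE; exact: polynomial_fun_fst.
under eq_fun do rewrite !mxE.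
by case: (j == k); [exact: polynomial_fun_snd | exact: polynomial_fun_fst].
Qed.

(** Choose the columns of [A] indexed by [J] to be the first [#|J|] unit vectors
    of ['cV_m], and [b] to be the [k]-th of them: replacing column [k] by [b]
    then changes nothing and the mixed Gram matrix is the identity. *)
Lemma exists_det_mixed_gram_neq0 J k :
  (#|J| <= m)%N -> exists A b, \det (mixed_gram A b J k) != 0.
Proof.
move=> Jm.
have [A AE] : exists A, forall i (h : 'I_#|J|),
    A i (enum_val h) = (i == h :> nat)%:R.
  exists (\matrix_(i, l)
    [exists h : 'I_#|J|, (enum_val h == l) && (i == h :> nat)]%:R) => i h.
  rewrite mxE; congr (_%:R); congr nat_of_bool.
  apply/existsP/idP => [[h' /andP[/eqP hh' ih']]|ih].
    by rewrite -(enum_val_inj hh').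
  by exists h; rewrite eqxx.
exists A, (\col_i (i == k :> nat)%:R).
have -> : mixed_gram A (\col_i (i == k :> nat)%:R) J k = 1%:M.
  apply/matrixP => h l; rewrite mxE.
  under eq_bigr => i _.
    have -> : replace_col A (\col_i (i == k :> nat)%:R) J k i l =
              (i == l :> nat)%:R.
      by rewrite !mxE; case: eqP => [->|_]; rewrite ?AE.
    rewrite !mxE AE.
  over.
  (* Column [h] of [cols A J] is a unit vector: one term of the sum is left. *)
  rewrite (bigD1 (widen_ord Jm h)) //= eqxx mul1r big1 ?addr0; last first.
    move=> i /negP hi; case: eqP => [ih|_]; rewrite ?mul0r //.
    by case: hi; apply/eqP/val_inj.
  by rewrite mxE.
by rewrite det1 oner_neq0.
Qed.

Definition generic_data s : set ('M[R]_(m, n) * 'cV[R]_m)%type :=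
  [set Ab | forall J, (#|J| <= s)%N ->
     forall k : 'I_#|J|, \det (mixed_gram Ab.1 Ab.2 J k) != 0].

Lemma open_dense_generic_data s :
  (s <= m)%N -> open (generic_data s) /\ dense (generic_data s).
Proof.
move=> sm.
pose index : Type := {J : {set 'I_n} & 'I_#|J|}.
pose F (i : index) : set ('M[R]_(m, n) * 'cV[R]_m)%type :=
  [set Ab | \det (mixed_gram Ab.1 Ab.2 (tag i) (tagged i)) != 0].
have -> : generic_data s =
    [set Ab | forall i : index, (#|tag i| <= s)%N -> F i Ab].
  apply/seteqP; split=> Ab gen; first by case=> J k /= Js; exact: gen.
  by move=> J Js k; exact: (gen (existT _ J k)).
apply: open_dense_finite_inter => -[J k] /= Js.
have pJk := polynomial_fun_det_mixed_gram J k.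
split; first exact: open_polynomial_fun_neq0.
apply: dense_polynomial_fun_neq0 => //.
have [A [b Ab]] := exists_det_mixed_gram_neq0 J k (leq_trans Js sm).
by exists (A, b).
Qed.

(** * First-order condition at a local minimizer *)

Lemma mulmx_cols_subvec A x J :
  I1 x \subset J -> cols A J *m subvec x J = A *m x.
Proof.
move=> xJ; apply/matrixP => i j; rewrite !mxE.
under eq_bigr do rewrite !mxE.
rewrite -(big_enum_val (fun l => A i l * x l j)) /=.
rewrite big_mkcond; apply: eq_bigr => l _.
case: ifPn => // lJ.
have : l \notin I1 x by apply: contra lJ => /(fintype.subsetP xJ).
by rewrite inE negbK !ord1 => /eqP ->; rewrite mulr0.
Qed.

Lemma SR_objective_line A b x j t :
  SR_objective A b (x + t *: delta_mx j 0) =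
  SR_objective A b x + t * (A^T *m (A *m x - b)) j 0
    + t ^+ 2 * (2^-1 * \sum_i A i j ^+ 2).
Proof.
have norm2E (v : 'cV[R]_m) : norm2 v ^+ 2 = \sum_i v i 0 ^+ 2.
  by rewrite sqr_sqrtr // sumr_ge0 // => i _; exact: sqr_ge0.
rewrite /SR_objective !norm2E mxE !mulr_sumr -!big_split /=.
apply: eq_bigr => i _.
have -> : (A *m (x + t *: delta_mx j 0) - b) i 0 = (A *m x - b) i 0 + t * A i j.
  by rewrite mulmxDr -scalemxAr -colE !mxE; ring.
by rewrite [A^T _ _]mxE; field.
Qed.

(** If [g != 0], a small step against [g] makes the linear term dominate and the
    quadratic negative. *)
Lemma near0_quadratic_ge0 (g c : R) :
  (\forall t \near (0 : R), 0 <= t * g + t ^+ 2 * c) -> g = 0.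
Proof.
move=> /nbhs_ballP [e /= e0 He].
apply/eqP; apply: contraT => g0.
(* The step [- d * g] must satisfy [d * |g| < e] and [d * |c| < 1]; both follow
   from [e * (d * |c|) + 2 * (d * |g|) = e], which defines [d]. *)
pose d := e / (e * `|c| + 2 * `|g|).
have D0 : 0 < e * `|c| + 2 * `|g|.
  by rewrite ltr_wpDl ?mulr_gt0 ?normr_gt0 // mulr_ge0 // ltW.
have d0 : 0 < d by rewrite divr_gt0.
have dE : e * (d * `|c|) + 2 * (d * `|g|) = e.
  by rewrite -[RHS](divfK (lt0r_neq0 D0)) -/d; ring.
have dg0 : 0 < d * `|g| by rewrite mulr_gt0 ?normr_gt0.
have dc0 : 0 <= d * `|c| by rewrite mulr_ge0 // ltW.
have dc1 : d * c < 1.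
  have dc : d * `|c| < 1 by nra.
  by apply: le_lt_trans dc; rewrite ler_pM2l // ler_norm.
have /He : ball (0 : R) e (- (d * g)).
  rewrite -ball_normE /= sub0r opprK normrM (gtr0_norm d0).
  by have := mulr_ge0 (ltW e0) dc0; lra.
have g2 : 0 < d * g ^+ 2 by rewrite mulr_gt0 // exprn_even_gt0.
by nra.
Qed.

(** Under the hypothesis on [j], the whole line through [x] in direction [j] is
    feasible, as its points have support in [j |: I1 x]. *)
Lemma local_minimizer_gradient s A b x j :
  (norm0 x < s)%N || (j \in I1 x) -> local_minimizer s A b x ->
  (A^T *m (A *m x - b)) j 0 = 0.
Proof.
move=> hj [xs]; rewrite /within /= => xmin.
apply: (near0_quadratic_ge0 _ (2^-1 * \sum_i A i j ^+ 2)).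
have xmin_line : \forall t \near (0 : R), let y := x + t *: delta_mx j 0 in
    sparse_vectors s y -> SR_objective A b x <= SR_objective A b y.
  exact: cvg_line xmin.
apply: filterS xmin_line => t /=.
rewrite SR_objective_line -addrA lerDl; apply.
have sub : I1 (x + t *: delta_mx j 0) \subset j |: I1 x.
  apply/fintype.subsetP => l; rewrite !inE !mxE eqxx andbT.
  by case: (l == j) => //=; rewrite mulr0 addr0.
rewrite /sparse_vectors /= /norm0.
apply: leq_trans (subset_leq_card sub) _.
rewrite cardsU1; case/orP: hj => [xs'|->]; last exact: xs.
by apply: leq_trans xs'; rewrite -[X in (_ <= X)%N]add1n leq_add2r leq_b1.
Qed.

(** * Consequences of genericity *)

Lemma mxrank_cols A b J k :
  \det (mixed_gram A b J k) != 0 -> \rank (cols A J) = #|J|.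
Proof.
rewrite -unitfE -unitmxE -row_full_unit => /eqP full.
apply/eqP; rewrite eqn_leq rank_leq_col /= -[X in (X <= _)%N]full.
by rewrite -[leqRHS]mxrank_tr mxrankM_maxl.
Qed.

(** The residual is the image under [replace_col A b J k] of a vector with entry
    [-1] at [k], which the nonsingular mixed Gram matrix cannot kill. *)
Lemma gradient_neq0 A b x J k :
  \det (mixed_gram A b J k) != 0 -> I1 x \subset J -> x (enum_val k) 0 = 0 ->
  (cols A J)^T *m (A *m x - b) != 0.
Proof.
move=> detN0 xJ xk.
pose z := subvec x J - delta_mx k 0.
have Cz : replace_col A b J k *m z = A *m x - b.
  rewrite mulmxBr -colE -(mulmx_cols_subvec _ _ _ xJ); congr (_ - _).
    apply/matrixP => i j; rewrite !mxE; apply: eq_bigr => l _.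
    by rewrite !mxE; case: eqP => // ->; rewrite ord1 xk !mulr0.
  by apply/matrixP => i j; rewrite !mxE eqxx ord1.
rewrite -Cz mulmxA; apply/eqP => Mz0.
have z0 : z = 0.
  have uM : mixed_gram A b J k \in unitmx by rewrite unitmxE unitfE.
  by rewrite -(mulKmx uM z) /mixed_gram Mz0 mulmx0.
have /eqP := congr1 (fun v : 'cV[R]_#|J| => v k 0) z0.
by rewrite !mxE xk !eqxx sub0r oppr_eq0 oner_eq0.
Qed.

End SparseRecoveryGenericity.

Theorem corollary1 (R : realType) (m n s : nat) (hsn : (s < n)%N)
    (hsm : (s <= m)%N) :
  exists U : set ('M[R]_(m, n) * 'cV[R]_m)%type,
    [/\ open U, dense U &
      forall (A : 'M[R]_(m, n)) (b : 'cV[R]_m), U (A, b) ->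
        forall x : 'cV[R]_n, local_minimizer s A b x ->
          nondegenerate_M_stationary s A b x /\ norm0 x = s].
Proof.
have [oU dU] := @open_dense_generic_data R m n s hsm.
exists (generic_data s); split=> // A b gen x xmin.
have xs : (norm0 x <= s)%N by case: xmin.
have xE : norm0 x = s.
  apply/eqP; rewrite eqn_leq xs /= leqNgt; apply/negP => ltxs.
  have [j xj] : exists j, j \notin I1 x.
    have /card_gt0P [j] : (0 < #|~: I1 x|)%N.
      by rewrite cardsCs finset.setCK card_ord subn_gt0 (ltn_trans ltxs).
    by rewrite finset.in_setC; exists j.
  pose J := j |: I1 x.
  have Jj : j \in J by rewrite setU11.
  have Js : (#|J| <= s)%N by rewrite cardsU1 xj.
  have := gradient_neq0 A b x J (enum_rank_in Jj j) (gen J Js _) (finset.subsetUr _ _).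
  rewrite enum_rankK_in //.
  move: xj; rewrite inE negbK => /eqP -> /(_ erefl) /eqP; apply.
  apply/matrixP => k l; rewrite [l]ord1 [RHS]mxE.
  have := @local_minimizer_gradient R m n s A b x (enum_val k) _ xmin.
  by rewrite ltxs => /(_ isT) <-; rewrite !mxE; apply: eq_bigr => i _; rewrite !mxE.
split=> //; split.
- split=> //.
  rewrite -mulmxA mulmx_cols_subvec // -mulmxBr.
  apply/matrixP => k l; rewrite [l]ord1 [RHS]mxE.
  have := @local_minimizer_gradient R m n s A b x (enum_val k) _ xmin.
  by rewrite enum_valP orbT => /(_ isT) <-; rewrite !mxE; apply: eq_bigr => i _; rewrite !mxE.
- by rewrite /ND1 xE ltnn.
- rewrite /ND2 /norm0.
  case: (posnP #|I1 x|) => [I0|Ipos].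
    by apply/eqP; rewrite eqn_leq rank_leq_col (leq_trans _ (leq0n _)) // I0.
  exact: (mxrank_cols A b (I1 x) (Ordinal Ipos)) (gen _ xs _).
Qed.
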